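(* Let $A\in\mathrm{Mat}_n(k)$ and let $\bar{I}$ be a maximal $\delta$-ideal in $\bar{k}[X,1/\det(X)]$, generated by a finite set $S\subset\bar{k}[X,1/\det(X)]$. Let $\tilde{k}\subset\bar{k}$ be a finite Galois extension of $k$ such that $S\subset\tilde{k}[X,1/\det(X)]$, and let $\{\rho_1(S),\dots,\rho_d(S)\}$ be the orbit of $S$ under the action of $\mathrm{Gal}(\tilde{k}/k)$. Then $$\mathfrak{m}=k[X,1/\det(X)]\cap\bigcap_{i=1}^d\langle\rho_i(S)\rangle_{\tilde{k}}$$ is a maximal $\delta$-ideal in $k[X,1/\det(X)]$.
   Context: $C$ is an algebraically closed field of characteristic zero, $k=C(t)$ is the field of rational functions in $t$ with derivation $\delta=d/dt$, and $\bar{k}$ is an algebraic closure of $k$ with the unique extension of $\delta$. $X=(X_{i,j})$ is an $n\times n$ matrix of indeterminates. For any field $K$ with $k\subset K\subset\bar{k}$, $K[X,1/\det(X)]$ is the $K$-algebra generated by the entries of $X$ and $1/\det(X)$; it is a differential ring extending $K$ via $\delta(X)=AX$. A $\delta$-ideal is an ideal $I$ with $\delta(I)\subset I$; a maximal $\delta$-ideal is a proper $\delta$-ideal maximal among proper $\delta$-ideals. $\mathrm{Gal}(\tilde{k}/k)$ acts on $\tilde{k}[X,1/\det(X)]$ by acting on coefficients (fixing $X$), and $\rho(S)=\{\rho(f): f\in S\}$ for $\rho\in\mathrm{Gal}(\tilde{k}/k)$. $\langle\rho_i(S)\rangle_{\tilde{k}}$ denotes the ideal of $\tilde{k}[X,1/\det(X)]$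 generated by $\rho_i(S)$. *)

(* Defs.v *)
From HB Require Import structures.
From mathcomp Require Import all_boot all_order all_fingroup all_algebra all_field.
From mathcomp Require Import mpoly ring generic_quotient.

Set Implicit Arguments.
Unset Strict Implicit.
Unset Printing Implicit Defensive.

Import GRing.Theory.
Local Open Scope ring_scope.

Local Notation "x %:F" := (@FracField.tofrac _ x).

Definition is_derivation (R : pzRingType) (d : R -> R) : Prop :=
  (forall x y, d (x + y) = d x + d y) /\
  (forall x y, d (x * y) = d x * y + x * d y).

(** ** Maps and derivations on fraction fields *)

(* Meaningful for injective morphisms [f] only, see [frac_mapE]. *)
Definition frac_map (R R' : idomainType) (f : R -> R') (x : {fraction R}) :
    {fraction R'} :=
  (f \n_(repr x))%:F / (f \d_(repr x))%:F.

(* The result does not depend on the representative of [x] when [d] is a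
   derivation, see [frac_derivE]. *)
Definition frac_deriv (R : idomainType) (d : R -> R) (x : {fraction R}) :
    {fraction R} :=
  let p := \n_(repr x) in let q := \d_(repr x) in
  (d p * q - p * d q)%:F / (q ^+ 2)%:F.

Lemma frac_repr (R : idomainType) (x : {fraction R}) :
  x = (\n_(repr x))%:F / (\d_(repr x))%:F.
Proof.
have d0 := denom_ratioP (repr x).
apply/(canRL (mulfK _)); first by rewrite tofrac_eq0.
rewrite -[X in X * _]reprK /FracField.tofrac; unlock.
rewrite -[LHS]FracField.pi_mul; apply/eqP.
rewrite FracField.equivf_def /FracField.mulf.
by rewrite !numden_Ratio ?mulf_neq0 ?oner_neq0 ?mulr1 // mulrC.
Qed.

Lemma frac_eq (R : idomainType) (a b p q : R) : b != 0 -> q != 0 ->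
  a%:F / b%:F = p%:F / q%:F -> a * q = p * b.
Proof.
move=> b0 q0 /eqP; rewrite eqr_div ?tofrac_eq0 // -!tofracM tofrac_eq.
by move/eqP.
Qed.

Lemma frac_mapE (R R' : idomainType) (f : {rmorphism R -> R'}) (p q : R) :
  injective f -> q != 0 ->
  frac_map f (p%:F / q%:F) = (f p)%:F / (f q)%:F.
Proof.
move=> injf q0; rewrite /frac_map; set x := p%:F / q%:F.
have d0 := denom_ratioP (repr x); have := frac_repr x.
rewrite {1}/x => /(frac_eq q0 d0) e.
have fn0 y : y != 0 -> (f y)%:F != 0.
  by move=> y0; rewrite tofrac_eq0 -(rmorph0 f) (inj_eq injf).
by apply/eqP; rewrite eqr_div ?fn0 // -!tofracM -!rmorphM -e.
Qed.

Lemma frac_derivE (R : idomainType) (d : R -> R) (p q : R) :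
  is_derivation d -> q != 0 ->
  frac_deriv d (p%:F / q%:F) = (d p * q - p * d q)%:F / (q ^+ 2)%:F.
Proof.
move=> [_ dM] q0; rewrite /frac_deriv; set x := p%:F / q%:F.
have := frac_repr x; have := denom_ratioP (repr x).
move: \n_(repr x) \d_(repr x) => a b b0.
rewrite {}/x => /(frac_eq q0 b0) e.
apply/eqP; rewrite eqr_div ?tofrac_eq0 ?expf_neq0 // -!tofracM tofrac_eq.
have e' := congr1 d e; rewrite !dM in e'.
apply/eqP.
have -> : (d a * b - a * d b) * q ^+ 2 =
  b * q * (d a * q + a * d q) - (a * q) * (d b * q + b * d q) by ring.
by rewrite -e -e'; ring.
Qed.

(** ** The differential ring [K[X, 1/det X]] *)

Section GLRing.

Variables (K : fieldType) (n : nat).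

Definition Xmx : 'M[{mpoly K[n * n]}]_n := \matrix_(i, j) 'X_(mxvec_index i j).

Definition FracX : fieldType := {fraction {mpoly K[n * n]}}.

(* [K[X, 1/det X]], as a subring of the rational function field [K(X)]. *)
Definition GLring (f : FracX) : Prop :=
  exists p m, f = p%:F / (\det Xmx ^+ m)%:F.

Variables (d : K -> K) (A : 'M[K]_n).

(* The derivation of [K[X]] that extends [d] and sends [X] to [A X], see
   [mpoly_der_is_derivation], [mpoly_derC] and [mpoly_derX]. *)
Definition mpoly_der (p : {mpoly K[n * n]}) : {mpoly K[n * n]} :=
  map_mpoly d p +
  \sum_i \sum_j (map_mx (@mpolyC (n * n) K) A *m Xmx) i j
                * mderiv (mxvec_index i j) p.

Lemma mpoly_der_is_derivation : is_derivation d -> is_derivation mpoly_der.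
Proof.
case=> dD dM.
have dB : zmod_morphism d.
  have d0 : d 0 = 0 by apply: (addrI (d 0)); rewrite -dD !addr0.
  have dN x : d (- x) = - d x.
    by apply: (addrI (d x)); rewrite -dD !subrr d0.
  by move=> x y; rewrite dD dN.
pose d' : {additive K -> K} := HB.pack d (GRing.isZmodMorphism.Build K K d dB).
have cf m p : (map_mpoly d p)@_m = d p@_m := mcoeff_map_mpoly d' m p.
split=> p q; rewrite /mpoly_der.
  have -> : map_mpoly d (p + q) = map_mpoly d p + map_mpoly d q.
    exact: (raddfD (map_mpoly d')).
  rewrite addrACA; congr (_ + _); rewrite -big_split /=; apply: eq_bigr => i _.
  by rewrite -big_split /=; apply: eq_bigr => j _; rewrite mderivD mulrDr.
have -> : map_mpoly d (p * q) = map_mpoly d p * q + p * map_mpoly d q.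
  apply/mpolyP=> m; rewrite mcoeffD cf !mcoeffM -[d _]/(d' _) raddf_sum.
  by rewrite -big_split /=; apply: eq_bigr => k _; rewrite !cf -dM.
rewrite mulrDl mulrDr addrACA; congr (_ + _).
rewrite mulr_suml mulr_sumr -big_split /=; apply: eq_bigr => i _.
rewrite mulr_suml mulr_sumr -big_split /=; apply: eq_bigr => j _.
by rewrite mderivM; ring.
Qed.

Lemma mpoly_derC c : is_derivation d -> mpoly_der c%:MP = (d c)%:MP.
Proof.
case=> dD _; have d0 : d 0 = 0 by apply: (addrI (d 0)); rewrite -dD !addr0.
rewrite /mpoly_der big1 ?addr0; last first.
  by move=> i _; rewrite big1 // => j _; rewrite mderivC mulr0.
rewrite /map_mpoly /mmap msuppC; case: eqVneq => [->|_].
  by rewrite big_nil d0 mpolyC0.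
by rewrite big_seq1 mmap11 mulr1 mcoeffC eqxx mulr1.
Qed.

Lemma mpoly_derX : is_derivation d ->
  map_mx mpoly_der Xmx = map_mx (@mpolyC (n * n) K) A *m Xmx.
Proof.
case=> dD dM; have d0 : d 0 = 0 by apply: (addrI (d 0)); rewrite -dD !addr0.
have d1 : d 1 = 0.
  by have := dM 1 1; rewrite !mulr1 mul1r => /eqP; rewrite -subr_eq subrr => /eqP.
apply/matrixP=> i j; rewrite [in LHS]mxE [Xmx i j]mxE /mpoly_der.
have -> : map_mpoly d 'X_(mxvec_index i j) = 0 :> {mpoly K[n * n]}.
  by rewrite /map_mpoly /mmap msuppX big_seq1 mcoeffX eqxx /= d1 mpolyC0 mul0r.
rewrite add0r; set M := _ *m Xmx.
have dX i' j' : mderiv (mxvec_index i' j') 'X_(mxvec_index i j)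
    = ((i' == i) && (j' == j))%:R :> {mpoly K[n * n]}.
  have -> : (i' == i) && (j' == j) = (mxvec_index i j == mxvec_index i' j').
    by rewrite [RHS](inj_eq enum_rank_inj) xpair_eqE eq_sym [j == _]eq_sym.
  rewrite mderivX mnm1E; case: eqP => [->|_]; last by rewrite scale0r.
  by rewrite -[X in (X - _)%MM]add0m addmK mpolyX0 scale1r.
rewrite (bigD1 i) //= [X in _ + X]big1 ?addr0; last first.
  by move=> i' /negPf ni; rewrite big1 // => j' _; rewrite dX ni mulr0.
rewrite (bigD1 j) //= big1 ?addr0 ?dX ?eqxx ?mulr1 //.
by move=> j' /negPf nj; rewrite dX nj andbF mulr0.
Qed.

Definition GLder : FracX -> FracX := frac_deriv mpoly_der.

End GLRing.

(* Acts on the coefficients and fixes [X]. *)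
Definition GLmap (K K' : fieldType) (n : nat) (f : K -> K') :
    FracX K n -> FracX K' n :=
  frac_map (map_mpoly f).

(** ** Ideals of a subring [B] of a ring [F], as predicates on [F] *)

Section Ideals.

Variables (F : comPzRingType) (B : F -> Prop).

Definition is_ideal (I : F -> Prop) : Prop :=
  [/\ forall x, I x -> B x,
      I 0,
      forall x y, I x -> I y -> I (x + y) &
      forall b x, B b -> I x -> I (b * x)].

Definition gen_ideal (S : seq F) (f : F) : Prop :=
  exists2 c : 'I_(size S) -> F,
    forall i, B (c i) & f = \sum_i c i * S`_i.

Definition is_delta_ideal (D : F -> F) (I : F -> Prop) : Prop :=
  is_ideal I /\ forall x, I x -> I (D x).

Definition is_proper (I : F -> Prop) : Prop := exists2 x, B x & ~ I x.

Definition is_max_delta_ideal (D : F -> F) (I : F -> Prop) : Prop :=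
  [/\ is_delta_ideal D I, is_proper I &
      forall J, is_delta_ideal D J -> is_proper J ->
        (forall x, I x -> J x) -> forall x, J x -> I x].

End Ideals.

(** ** The differential field [C(t)] *)

Definition ratfun (C : fieldType) : fieldType := {fraction {poly C}}.

Definition ddt (C : fieldType) : ratfun C -> ratfun C := frac_deriv (@deriv C).

(* Main.v *)
Require Import Defs.
From HB Require Import structures.
From mathcomp Require Import all_boot all_order all_fingroup all_algebra all_field.
From mathcomp Require Import boolp classical_sets.
From mathcomp Require Import mpoly ring generic_quotient.

(** Applying [rho_i^-1] and descending from [kbar] to [L], one finds that [m] is
    the contraction of [Ibar] to [R_k = k[X, 1/det X]]. Let [M] be a proper
    delta-ideal of [R_k] containing [m]. The delta-ideal [M R_kbar + Ibar] is
    either contained in [Ibar], and then [M] is contained in [m], or it contains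
    [1]. In the latter case linear algebra gives [1 = u + v] over [L], with [u]
    in [M R_L] and [v] in the ideal generated by [S]. The norm of
    [v = 1 - u] under the Galois group lies in [m], hence in [M], but also in
    [1 + M R_L]; so [1] lies in [M R_L], and therefore in [M]. *)

Set Implicit Arguments.
Unset Strict Implicit.
Unset Printing Implicit Defensive.

Import GRing.Theory.
Local Open Scope ring_scope.

Local Notation "x %:F" := (@FracField.tofrac _ x).

(** The closure conditions on a coefficient ring that the general lemmas on ideals rely on; they are
    applied with [B] equal to [GLring]. *)
Definition is_subsemiring (R : pzSemiRingType) (B : R -> Prop) : Prop :=
  [/\ B 0, B 1, forall x y, B x -> B y -> B (x + y) &
      forall x y, B x -> B y -> B (x * y)].

(** * Derivations and morphisms on fraction fields *)

Lemma fracP (R : idomainType) (x : {fraction R}) :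
  exists p q, q != 0 /\ x = p%:F / q%:F.
Proof.
exists (\n_(repr x)), (\d_(repr x)).
by rewrite -frac_repr; split=> //; apply: denom_ratioP.
Qed.

Lemma addf_tofrac (R : idomainType) (p q a b : R) : q != 0 -> b != 0 ->
  p%:F / q%:F + a%:F / b%:F = (p * b + a * q)%:F / (q * b)%:F.
Proof. by move=> q0 b0; rewrite addf_div ?tofrac_eq0 // tofracD !tofracM. Qed.

Lemma mulf_tofrac (R : idomainType) (p q a b : R) :
  (p%:F / q%:F) * (a%:F / b%:F) = (p * a)%:F / (q * b)%:F.
Proof. by rewrite mulf_div !tofracM. Qed.

Lemma eqr_tofrac (R : idomainType) (p q a b : R) : q != 0 -> b != 0 ->
  p * b = a * q -> p%:F / q%:F = a%:F / b%:F.
Proof.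
move=> q0 b0 e.
by apply/eqP; rewrite eqr_div ?tofrac_eq0 // -!tofracM tofrac_eq e.
Qed.

Lemma frac_deriv_is_derivation (R : idomainType) (d : R -> R) :
  is_derivation d -> is_derivation (frac_deriv d).
Proof.
move=> dder; have [dD dM] := dder.
split=> x y; have [p [q [q0 ->]]] := fracP x; have [a [b [b0 ->]]] := fracP y.
  rewrite addf_tofrac // !frac_derivE ?mulf_neq0 //.
  rewrite addf_tofrac ?expf_neq0 //.
  apply: eqr_tofrac; rewrite ?mulf_neq0 ?expf_neq0 ?mulf_neq0 //.
  rewrite dD !dM; ring.
rewrite mulf_tofrac !frac_derivE ?mulf_neq0 //.
rewrite !mulf_tofrac addf_tofrac ?mulf_neq0 ?expf_neq0 //.
apply: eqr_tofrac; rewrite ?mulf_neq0 ?expf_neq0 ?mulf_neq0 //.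
rewrite !dM; ring.
Qed.

Lemma frac_map_is_rmorphism (R R' : idomainType) (f : {rmorphism R -> R'}) :
  injective f -> zmod_morphism (frac_map f) * monoid_morphism (frac_map f).
Proof.
move=> injf; have nz y : y != 0 -> f y != 0.
  by move=> y0; rewrite -(rmorph0 f) (inj_eq injf).
split=> [x y|]; last split=> [|x y].
- have [p [q [q0 ->]]] := fracP x; have [a [b [b0 ->]]] := fracP y.
  rewrite -[- (_ %:F / _)]mulNr -tofracN addf_tofrac // !frac_mapE ?mulf_neq0 //.
  rewrite -mulNr -tofracN addf_tofrac ?nz //.
  by rewrite rmorphD !rmorphM rmorphN.
- have <- : 1%:F / 1%:F = 1 :> {fraction R} by rewrite tofrac1 divr1.
  by rewrite frac_mapE ?oner_neq0 // rmorph1 tofrac1 divr1.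
- have [p [q [q0 ->]]] := fracP x; have [a [b [b0 ->]]] := fracP y.
  by rewrite mulf_tofrac !frac_mapE ?mulf_neq0 // mulf_tofrac !rmorphM.
Qed.

Lemma map_mpoly_inj (m : nat) (K K' : fieldType) (f : {rmorphism K -> K'}) :
  injective (map_mpoly f : {mpoly K[m]} -> {mpoly K'[m]}).
Proof.
move=> p q e; apply/mpolyP=> k; apply: (fmorph_inj f).
by rewrite -!mcoeff_map_mpoly e.
Qed.

(** * Change of the base field in [K(X)] *)

Section GLmapMorphism.
Variables (K K' : fieldType) (n : nat) (f : {rmorphism K -> K'}).

Let GLmap_rmorph :=
  frac_map_is_rmorphism (f := map_mpoly f) (@map_mpoly_inj (n * n) K K' f).

HB.instance Definition _ :=
  GRing.isZmodMorphism.Build (FracX K n) (FracX K' n) (@GLmap K K' n f)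
    GLmap_rmorph.1.
HB.instance Definition _ :=
  GRing.isMonoidMorphism.Build (FracX K n) (FracX K' n) (@GLmap K K' n f)
    GLmap_rmorph.2.

End GLmapMorphism.

(** Evaluation at the identity matrix sends the determinant to 1. *)
Lemma det_Xmx_neq0 (K : fieldType) (n : nat) : \det (Xmx K n) != 0.
Proof.
pose v k := mxvec (1%:M : 'M[K]_n) 0 k.
apply/eqP => /(congr1 (meval v)); rewrite meval0 -det_map_mx.
have -> : map_mx (meval v) (Xmx K n) = 1%:M.
  by apply/matrixP=> i j; rewrite !mxE mevalXU /v mxvecE mxE.
by rewrite det1 => /eqP; rewrite oner_eq0.
Qed.

Lemma map_Xmx (K K' : fieldType) (n : nat) (f : {rmorphism K -> K'}) :
  map_mx (map_mpoly f) (Xmx K n) = Xmx K' n.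
Proof. by apply/matrixP=> i j; rewrite !mxE map_mpolyX. Qed.

Lemma map_det_Xmx (K K' : fieldType) (n : nat) (f : {rmorphism K -> K'}) :
  map_mpoly f (\det (Xmx K n)) = \det (Xmx K' n).
Proof. by rewrite -det_map_mx map_Xmx. Qed.

Lemma GLmapE (K K' : fieldType) (n : nat) (f : {rmorphism K -> K'}) p m :
  GLmap f (p%:F / (\det (Xmx K n) ^+ m)%:F)
  = (map_mpoly f p)%:F / (\det (Xmx K' n) ^+ m)%:F.
Proof.
rewrite /GLmap frac_mapE ?expf_neq0 ?det_Xmx_neq0 //; last exact: map_mpoly_inj.
by rewrite rmorphXn /= map_det_Xmx.
Qed.

Lemma GLmap_comp (K K' K'' : fieldType) (n : nat) (f : {rmorphism K -> K'})
    (g : {rmorphism K' -> K''}) (h : {rmorphism K -> K''}) :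
  (forall a, g (f a) = h a) ->
  forall x : FracX K n, GLmap g (GLmap f x) = GLmap h x.
Proof.
move=> gfh x; have [p [q [q0 ->]]] := fracP x.
have e r : map_mpoly g (map_mpoly f r) = map_mpoly h r.
  by apply/mpolyP=> k; rewrite !mcoeff_map_mpoly /= gfh.
have fq0 : map_mpoly f q != 0.
  by rewrite -(rmorph0 (map_mpoly f)) (inj_eq (@map_mpoly_inj _ _ _ f)).
rewrite /GLmap (frac_mapE _ (@map_mpoly_inj _ _ _ f) q0).
rewrite (frac_mapE _ (@map_mpoly_inj _ _ _ h) q0).
by rewrite (frac_mapE _ (@map_mpoly_inj _ _ _ g) fq0) /= !e.
Qed.

Lemma GLmap_id (K : fieldType) (n : nat) (f : {rmorphism K -> K}) :
  f =1 id -> forall x : FracX K n, GLmap f x = x.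
Proof.
move=> fid x; have [p [q [q0 ->]]] := fracP x.
have e r : map_mpoly f r = r :> {mpoly K[n * n]}.
  by apply/mpolyP=> k; rewrite !mcoeff_map_mpoly /= fid.
by rewrite /GLmap (frac_mapE _ (@map_mpoly_inj _ _ _ f) q0) /= !e.
Qed.

Lemma derivation_is_zmod_morphism (R : pzRingType) (d : R -> R) :
  is_derivation d -> zmod_morphism d.
Proof.
case=> dD _; have d0 : d 0 = 0 by apply: (addrI (d 0)); rewrite -dD !addr0.
have dN x : d (- x) = - d x by apply: (addrI (d x)); rewrite -dD !subrr d0.
by move=> x y; rewrite dD dN.
Qed.

Definition derivation_additive (R : pzRingType) (d : R -> R)
    (dder : is_derivation d) : {additive R -> R} :=
  HB.pack d
    (GRing.isZmodMorphism.Build R R d (derivation_is_zmod_morphism dder)).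

(** * Closure properties of [K[X, 1/det X]] and common denominators *)

Section GLringClosure.
Variables (K : fieldType) (n : nat).

(** Allowing every exponent from some [N] on makes it possible to bring several families to one and
    the same power of the determinant. *)
Lemma GLring_common (m : nat) (x : 'I_m -> FracX K n) :
  (forall i, GLring (x i)) ->
  exists N, forall M, (N <= M)%N ->
    exists p, forall i, x i = (p i)%:F / (\det (Xmx K n) ^+ M)%:F.
Proof.
move=> xB; have /choice[f fE] : forall i, exists pm : {mpoly K[n * n]} * nat,
    x i = pm.1%:F / (\det (Xmx K n) ^+ pm.2)%:F.
  by move=> i; have [p [k ->]] := xB i; exists (p, k).
exists (\max_i (f i).2) => M NM.
exists (fun i => (f i).1 * \det (Xmx K n) ^+ (M - (f i).2)) => i.
have le : ((f i).2 <= M)%N by apply: leq_trans NM; apply: leq_bigmax.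
rewrite fE; apply: eqr_tofrac; rewrite ?expf_neq0 ?det_Xmx_neq0 //.
by rewrite -mulrA -exprD subnK.
Qed.

Lemma GLring_pair (x y : FracX K n) : GLring x -> GLring y ->
  exists p q N, x = p%:F / (\det (Xmx K n) ^+ N)%:F
             /\ y = q%:F / (\det (Xmx K n) ^+ N)%:F.
Proof.
move=> xB yB; pose z (i : 'I_2) := if i == ord0 then x else y.
have [|N /(_ N (leqnn N))[p pE]] := @GLring_common 2 z.
  by move=> i; rewrite /z; case: ifP.
by exists (p ord0), (p ord_max), N; split; [have := pE ord0 | have := pE ord_max].
Qed.

Lemma GLringD (x y : FracX K n) : GLring x -> GLring y -> GLring (x + y).
Proof.
move=> xB yB; have [p [q [N [-> ->]]]] := GLring_pair xB yB.
by exists (p + q), N; rewrite tofracD mulrDl.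
Qed.

Lemma GLringM (x y : FracX K n) : GLring x -> GLring y -> GLring (x * y).
Proof.
move=> [p [k ->]] [q [l ->]]; exists (p * q), (k + l)%N.
by rewrite mulf_tofrac exprD.
Qed.

Lemma GLringC (p : {mpoly K[n * n]}) : GLring p%:F.
Proof. by exists p, 0; rewrite expr0 tofrac1 divr1. Qed.

Lemma GLring0 : GLring (0 : FracX K n).
Proof. by rewrite -tofrac0; apply: GLringC. Qed.

Lemma GLring1 : GLring (1 : FracX K n).
Proof. by rewrite -tofrac1; apply: GLringC. Qed.

Lemma GLringN (x : FracX K n) : GLring x -> GLring (- x).
Proof. by move=> [p [k ->]]; exists (- p), k; rewrite tofracN mulNr. Qed.

Lemma GLring_subsemiring : is_subsemiring (@GLring K n).
Proof.
split; [exact: GLring0|exact: GLring1|exact: GLringD|exact: GLringM].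
Qed.

Variables (d : K -> K) (A : 'M[K]_n).
Hypothesis dder : is_derivation d.

Lemma GLder_is_derivation : is_derivation (GLder d A).
Proof. exact/frac_deriv_is_derivation/mpoly_der_is_derivation. Qed.

Lemma GLringder (x : FracX K n) : GLring x -> GLring (GLder d A x).
Proof.
move=> [p [k ->]].
rewrite /GLder frac_derivE ?expf_neq0 ?det_Xmx_neq0 //; last first.
  exact: mpoly_der_is_derivation.
by rewrite -exprM; eexists; eexists.
Qed.

End GLringClosure.

Lemma GLring_map (K K' : fieldType) (n : nat) (f : {rmorphism K -> K'})
    (x : FracX K n) :
  GLring x -> GLring (GLmap f x).
Proof. by move=> [p [k ->]]; rewrite GLmapE; eexists; eexists. Qed.

(** Both sides obey the quotient rule, so it is enough to compare them on polynomials. There the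
    coefficient part uses the compatibility of [f] with [d] and [d'], and the part coming from [A X]
    is formal. *)
Lemma GLmap_der (K K' : fieldType) (n : nat) (f : {rmorphism K -> K'})
    (d : K -> K) (d' : K' -> K') (A : 'M[K]_n) :
    is_derivation d -> is_derivation d' -> (forall a, d' (f a) = f (d a)) ->
  forall x, GLmap f (GLder d A x) = GLder d' (map_mx f A) (GLmap f x).
Proof.
move=> dder dder' fd x; have [p [q [q0 ->]]] := fracP x.
have fq0 : map_mpoly f q != 0.
  by rewrite -(rmorph0 (map_mpoly f)) (inj_eq (@map_mpoly_inj _ _ _ f)).
have mder := mpoly_der_is_derivation A dder.
have mder' := mpoly_der_is_derivation (map_mx f A) dder'.
have e r : map_mpoly f (mpoly_der d A r)
    = mpoly_der d' (map_mx f A) (map_mpoly f r).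
  rewrite /mpoly_der rmorphD; congr (_ + _).
    apply/mpolyP=> m; rewrite mcoeff_map_mpoly.
    rewrite (mcoeff_map_mpoly (derivation_additive dder)).
    rewrite (mcoeff_map_mpoly (derivation_additive dder')).
    by rewrite mcoeff_map_mpoly /= fd.
  rewrite rmorph_sum; apply: eq_bigr => i _; rewrite rmorph_sum.
  apply: eq_bigr => k _; rewrite rmorphM /=; congr (_ * _).
    rewrite !mxE rmorph_sum; apply: eq_bigr => l _.
    by rewrite rmorphM !mxE /= map_mpolyX map_mpolyC.
  by apply/mpolyP=> m; rewrite mcoeff_map_mpoly !mcoeff_mderiv mcoeff_map_mpoly raddfMn.
rewrite /GLder /GLmap (frac_mapE _ (@map_mpoly_inj _ _ _ f) q0).
rewrite (frac_derivE _ mder q0) (frac_derivE _ mder' fq0).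
rewrite (frac_mapE _ (@map_mpoly_inj _ _ _ f)) ?expf_neq0 //.
by rewrite /= rmorphXn rmorphB !rmorphM /= !e.
Qed.

(* A complement of [E] in [F] is a subspace maximal among those avoiding 1. *)
Lemma field_ext_retraction (E F : fieldType) (f : {rmorphism E -> F}) :
  exists r : {additive F -> E},
    (forall a x, r (f a * x) = a * r x) /\ r 1 = 1.
Proof.
(* The empty set satisfies [P], as it must for the union of an empty chain; that the maximal [W]
   contains 0 is then deduced from maximality by comparison with [{0}]. *)
pose P (W : F -> Prop) := [/\ forall x y, W x -> W y -> W (x + y),
  forall a x, W x -> W (f a * x) & ~ W 1].
have [|W [[WD WZ W1] Wmax]] := @Zorn_bigcup F P.
  move=> H HP Htot; split.
  - move=> x y [U HU Ux] [V HV Vy].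
    have [UV|VU] := Htot U V HU HV.
      by exists V => //; have [VD _ _] := HP V HV; apply: VD => //; apply: UV.
    by exists U => //; have [UD _ _] := HP U HU; apply: UD => //; apply: VU.
  - by move=> a x [U HU Ux]; exists U => //; have [_ UZ _] := HP U HU; apply: UZ.
  - by move=> [U HU U1]; have [_ _ []] := HP U HU.
have W0 : W 0.
  case: (EM (W 0)) => // nW0.
  have e0 x : W x -> False by move=> /(WZ 0); rewrite rmorph0 mul0r.
  have [] := Wmax [set 0]%classic.
    by split=> [x /e0 //|/(_ 0 erefl)].
  split=> [_ _ -> ->|a _ ->|/esym/eqP]; rewrite ?addr0 ?mulr0 //.
  by rewrite eq_sym oner_eq0.
have WN x : W x -> W (- x).
  by move=> /(WZ (-1)); rewrite rmorphN1 mulN1r.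
(* Every [y] lies in [W + f(E)]. Otherwise [V = W + f(E) y] is strictly larger than [W] and still
   avoids 1: if [1 - f a * y] were in [W], then [a] would be nonzero, and scaling by its inverse
   would put [y - f a^-1] in [W]. *)
have ex y : exists a, W (y - f a).
  case: (EM (W y)) => [Wy|nWy]; first by exists 0; rewrite rmorph0 subr0.
  case: (EM (exists a, W (y - f a))) => // ny.
  pose V z := exists a, W (z - f a * y).
  have [] := Wmax V.
    split=> [x Wx|VW]; first by exists 0; rewrite rmorph0 mul0r subr0.
    by apply/nWy/VW; exists 1; rewrite rmorph1 mul1r subrr.
  split=> [u v [a ua] [b vb]|a u [b ub]|[a]].
  - by exists (a + b); rewrite rmorphD mulrDl opprD addrACA; apply: WD.
  - by exists (a * b); rewrite rmorphM -mulrA -mulrBr; apply: WZ.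
  - have [->|a0] := eqVneq a 0; first by rewrite rmorph0 mul0r subr0.
    move=> /(WZ a^-1); rewrite mulrBr mulr1 mulrA -rmorphM mulVf // rmorph1 mul1r.
    by move=> /WN; rewrite opprB => Wy; apply: ny; exists a^-1.
have [r rW] := choice ex.
(* [W] meets [f(E)] only in 0, since a nonzero element of the intersection could be scaled to 1.
   This uniqueness makes the chosen [r] additive and [E]-linear. *)
have runiq y a : W (y - f a) -> r y = a.
  move=> Wa; apply/eqP; rewrite -subr_eq0; apply/eqP.
  case: (eqVneq (r y - a) 0) => // ra0; case: W1.
  have /WN := WD _ _ (rW y) (WN _ Wa).
  have -> : - (y - f (r y) - (y - f a)) = f (r y - a) by rewrite rmorphB; ring.
  move=> /(WZ (r y - a)^-1).
  by rewrite -rmorphM mulVf // rmorph1.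
have rB : zmod_morphism r.
  move=> x y; apply: runiq.
  by rewrite rmorphB opprD addrACA -opprD; apply: WD => //; apply: WN.
pose ra : {additive F -> E} := HB.pack r (GRing.isZmodMorphism.Build F E r rB).
exists ra; split=> /=.
  by move=> a x; apply: runiq; rewrite rmorphM -mulrBr; apply: WZ.
by apply: runiq; rewrite rmorph1 subrr.
Qed.

(** * Finitely generated ideals, their sums and their derivatives *)

Section Ideals.
Variables (F : comPzRingType) (B : F -> Prop).
Hypothesis subB : is_subsemiring B.

Let BD x y : B x -> B y -> B (x + y). Proof. by case: subB => _ _ + _; apply. Qed.
Let BM x y : B x -> B y -> B (x * y). Proof. by case: subB => _ _ _; apply. Qed.
Let B0 : B 0. Proof. by case: subB. Qed.
Let B1 : B 1. Proof. by case: subB. Qed.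

Lemma is_ideal_sum (I : F -> Prop) (T : Type) (s : seq T) (c : T -> F) :
  is_ideal B I -> (forall i, I (c i)) -> I (\sum_(i <- s) c i).
Proof. by move=> [_ I0 ID _] Ic; apply: big_ind. Qed.

Lemma gen_ideal_min (I : F -> Prop) (S : seq F) :
  is_ideal B I -> (forall s, s \in S -> I s) ->
  forall f, gen_ideal B S f -> I f.
Proof.
move=> Iid IS f [c cB ->]; have [_ _ _ IM] := Iid.
by apply: is_ideal_sum Iid _ => i; apply/IM/IS/mem_nth.
Qed.

Lemma gen_ideal_is_ideal (S : seq F) : (forall s, s \in S -> B s) ->
  is_ideal B (gen_ideal B S).
Proof.
move=> SB; split.
- move=> _ [c cB ->]; apply: big_ind => // i _.
  by apply: BM => //; apply/SB/mem_nth.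
- by exists (fun=> 0) => //; rewrite big1 // => i _; rewrite mul0r.
- move=> _ _ [c cB ->] [e eB ->]; exists (fun i => c i + e i); first by auto.
  by rewrite -big_split /=; apply: eq_bigr => i _; rewrite mulrDl.
- move=> b _ bB [c cB ->]; exists (fun i => b * c i); first by auto.
  by rewrite mulr_sumr; apply: eq_bigr => i _; rewrite mulrA.
Qed.

Lemma mem_gen_ideal (S : seq F) s : s \in S -> gen_ideal B S s.
Proof.
move=> sS; have ltS : (index s S < size S)%N by rewrite index_mem.
exists (fun i => (i == Ordinal ltS)%:R) => [i|]; first by case: eqP.
rewrite (bigD1 (Ordinal ltS)) //= eqxx mul1r nth_index // big1 ?addr0 //.
by move=> i /negPf ->; rewrite mul0r.
Qed.

Lemma sub_gen_ideal (S T : seq F) : (forall s, s \in T -> B s) ->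
  {subset S <= T} -> forall f, gen_ideal B S f -> gen_ideal B T f.
Proof.
move=> TB ST; apply: gen_ideal_min; first exact: gen_ideal_is_ideal.
by move=> s /ST /mem_gen_ideal.
Qed.

Lemma is_idealD (I J : F -> Prop) : is_ideal B I -> is_ideal B J ->
  is_ideal B (fun x => exists a b, [/\ I a, J b & x = a + b]).
Proof.
move=> [IB I0 ID IM] [JB J0 JD JM]; split.
- by move=> _ [a [b [/IB aB /JB bB ->]]]; apply: BD.
- by exists 0, 0; rewrite addr0.
- move=> _ _ [a [b [Ia Jb ->]]] [a' [b' [Ia' Jb' ->]]].
  by exists (a + a'), (b + b'); rewrite addrACA; split; auto.
- move=> c _ cB [a [b [Ia Jb ->]]].
  by exists (c * a), (c * b); rewrite mulrDr; split; auto.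
Qed.

Lemma gen_ideal_cat (S T : seq F) f : (forall s, s \in S ++ T -> B s) ->
  gen_ideal B (S ++ T) f <->
  exists a b, [/\ gen_ideal B S a, gen_ideal B T b & f = a + b].
Proof.
move=> STB.
have SB s : s \in S -> B s by move=> sS; apply: STB; rewrite mem_cat sS.
have TB s : s \in T -> B s by move=> sT; apply: STB; rewrite mem_cat sT orbT.
have Sid := gen_ideal_is_ideal SB; have Tid := gen_ideal_is_ideal TB.
split.
  move: f; apply: gen_ideal_min; first exact: is_idealD.
  have [_ S0 _ _] := Sid; have [_ T0 _ _] := Tid.
  move=> s; rewrite mem_cat => /orP[] sS.
    by exists s, 0; rewrite addr0; split=> //; apply: mem_gen_ideal.
  by exists 0, s; rewrite add0r; split=> //; apply: mem_gen_ideal.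
move=> [a [b [aS bT ->]]]; have [_ _ D _] := gen_ideal_is_ideal STB.
apply: D; [move: aS | move: bT]; apply: sub_gen_ideal => // s sS.
  by rewrite mem_cat sS.
by rewrite mem_cat sS orbT.
Qed.

(** Coefficients indexed by [nat] have a type independent of [size S], which is convenient when [S]
    is replaced by its image under a map. *)
Lemma gen_ideal_natP (S : seq F) f : gen_ideal B S f <->
  exists2 c : nat -> F, forall i, B (c i) & f = \sum_(i < size S) c i * S`_i.
Proof.
split=> [[c cB ->]|[c cB ->]]; last by exists c.
exists (fun i => oapp c 0 (insub i)) => [i|]; first by case: (insub i) => [k|] /=.
by apply: eq_bigr => i _; rewrite valK.
Qed.

Lemma proper_ideal_not1 (I : F -> Prop) : is_ideal B I -> is_proper B I -> ~ I 1.
Proof.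
by move=> [_ _ _ IM] [x xB nIx] I1; apply: nIx; rewrite -[x]mulr1; apply: IM.
Qed.

Lemma derivation0 (D : F -> F) : is_derivation D -> D 0 = 0.
Proof. by case=> DD _; apply: (addrI (D 0)); rewrite -DD !addr0. Qed.

(** The list [T] makes room for derivatives of elements of [S], which may leave the ideal generated
    by [S]. *)
Lemma gen_ideal_der (D : F -> F) (S T : seq F) :
    is_derivation D -> (forall x, B x -> B (D x)) ->
    (forall s, s \in T -> B s) -> {subset S <= T} ->
    (forall s, s \in S -> gen_ideal B T (D s)) ->
  forall f, gen_ideal B S f -> gen_ideal B T (D f).
Proof.
move=> Dder DB TB ST DS f fS.
have [TIB T0 TD TM] := gen_ideal_is_ideal TB; have [DD DM] := Dder.
(* The two memberships are proved together, because [D (b * x) = D b * x + b * D x] involves both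
   [x] and [D x]. *)
suff [] : gen_ideal B T f /\ gen_ideal B T (D f) by [].
move: f fS; apply: gen_ideal_min => [|s sS]; last first.
  by split; [apply/mem_gen_ideal/ST | apply: DS].
split.
- by move=> x [/TIB].
- by rewrite derivation0.
- by move=> x y [Tx TDx] [Ty TDy]; rewrite DD; split; apply: TD.
- move=> b x bB [Tx TDx]; rewrite DM; split; first exact: TM.
  by apply: TD; apply: TM => //; apply: DB.
Qed.

(** * Extension of an ideal along a map *)

Section ExtendedIdeal.
Variables (E : comPzRingType) (phi : E -> F) (M : E -> Prop).
Hypothesis phiB : forall x, M x -> B (phi x).

(** The ideal generated by [phi(M)]. As [M] may be infinite and [gen_ideal] takes a list, each
    element carries its own finite list of generators. *)
Definition ext_ideal (f : F) : Prop :=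
  exists2 s : seq E, forall y, y \in s -> M y & gen_ideal B (map phi s) f.

Let mapB s : (forall y, y \in s -> M y) -> forall y, y \in map phi s -> B y.
Proof. by move=> sM _ /mapP[y /sM/phiB yB ->]. Qed.

Let catM s t : (forall y, y \in s -> M y) -> (forall y, y \in t -> M y) ->
  forall y, y \in s ++ t -> M y.
Proof. by move=> sM tM y; rewrite mem_cat => /orP[/sM|/tM]. Qed.

Lemma mem_ext_ideal x : M x -> ext_ideal (phi x).
Proof.
exists [:: x] => [y|]; first by rewrite inE => /eqP ->.
exact/mem_gen_ideal/mem_head.
Qed.

Lemma ext_ideal_is_ideal : is_ideal B ext_ideal.
Proof.
split.
- move=> f [s sM].
  by have [+ _ _ _] := gen_ideal_is_ideal (mapB sM); apply.
- have nilM y : y \in [::] -> M y by [].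
  by exists [::] => //; case: (gen_ideal_is_ideal (mapB nilM)).
- move=> f g [s sM fs] [t tM gt]; have stM := catM sM tM.
  exists (s ++ t) => //.
  have [_ _ + _] := gen_ideal_is_ideal (mapB stM); apply.
    move: fs; apply: sub_gen_ideal; first exact: mapB.
    by move=> y ys; rewrite map_cat mem_cat ys.
  move: gt; apply: sub_gen_ideal; first exact: mapB.
  by move=> y ys; rewrite map_cat mem_cat ys orbT.
- move=> b f bB [s sM fs]; exists s => //.
  by have [_ _ _ +] := gen_ideal_is_ideal (mapB sM); apply.
Qed.

(** If [f] is generated by the images of [s], then [D f] is generated by the images of [s] and of
    the derivatives of [s], which are again in [M]. *)
Lemma ext_ideal_der (D' : E -> E) (D : F -> F) :
    is_derivation D -> (forall x, B x -> B (D x)) ->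
    (forall x, D (phi x) = phi (D' x)) -> (forall x, M x -> M (D' x)) ->
  forall f, ext_ideal f -> ext_ideal (D f).
Proof.
move=> Dder DB Dphi MD f [s sM fs].
have D'M y : y \in map D' s -> M y by move=> /mapP[z /sM Mz ->]; apply: MD.
have tM := catM sM D'M; exists (s ++ map D' s) => //.
move: f fs; apply: gen_ideal_der => //; first exact: mapB.
  by move=> y ys; rewrite map_cat mem_cat ys.
move=> _ /mapP[y ys ->]; rewrite Dphi; apply: mem_gen_ideal.
by apply: map_f; rewrite mem_cat map_f ?orbT.
Qed.

End ExtendedIdeal.

End Ideals.

(** * Descent of ideal membership along a field extension *)

Section Extension.
Variables (K K' : fieldType) (n : nat) (f : {rmorphism K -> K'}).

Lemma gen_ideal_map (S : seq (FracX K n)) x :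
  gen_ideal (@GLring K n) S x ->
  gen_ideal (@GLring K' n) (map (GLmap f) S) (GLmap f x).
Proof.
move=> /(gen_ideal_natP (GLring_subsemiring K n))[c cB ->].
apply/(gen_ideal_natP (GLring_subsemiring K' n)).
exists (fun i => GLmap f (c i)) => [i|]; first exact: GLring_map.
rewrite rmorph_sum size_map; apply: eq_bigr => i _.
by rewrite rmorphM (nth_map 0).
Qed.

Lemma map_mpoly_retractionM (r : {additive K' -> K})
    (rZ : forall a x, r (f a * x) = a * r x) (m : nat)
    (p : {mpoly K'[m]}) (q : {mpoly K[m]}) :
  map_mpoly r (p * map_mpoly f q) = map_mpoly r p * q.
Proof.
apply/mpolyP=> k; rewrite mcoeff_map_mpoly !mcoeffM raddf_sum.
apply: eq_bigr => l _.
by rewrite !mcoeff_map_mpoly /= mulrC rZ mulrC.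
Qed.

Lemma map_mpoly_retractionK (r : {additive K' -> K})
    (rZ : forall a x, r (f a * x) = a * r x) (m : nat) :
  r 1 = 1 -> cancel (map_mpoly f) (map_mpoly r : {mpoly K'[m]} -> {mpoly K[m]}).
Proof.
move=> r1 p; apply/mpolyP=> k; rewrite !mcoeff_map_mpoly /=.
by rewrite -[f _]mulr1 rZ r1 mulr1.
Qed.

(* Clear denominators and apply a retraction [K' -> K] to the coefficients. *)
Lemma gen_ideal_descent (S : seq (FracX K n)) x :
    (forall s, s \in S -> GLring s) -> GLring x ->
    gen_ideal (@GLring K' n) (map (GLmap f) S) (GLmap f x) ->
  gen_ideal (@GLring K n) S x.
Proof.
move=> SB xB /(gen_ideal_natP (GLring_subsemiring K' n))[c cB].
rewrite size_map; under eq_bigr => i _ do rewrite (nth_map 0) //.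
have [r [rZ r1]] := field_ext_retraction f.
have [N /(_ N (leqnn N))[C CE]] := GLring_common (fun i : 'I_(size S) => cB i).
have [|M SM] := @GLring_common _ _ _ (fun i : 'I_(size S) => S`_i).
  by move=> i; apply/SB/mem_nth.
have [M' xM] := GLring_common (fun _ : 'I_1 => xB).
have [p pE] := SM _ (leq_maxl M M').
have [q /(_ ord0) qE] := xM _ (leq_maxr M M').
move: (maxn M M') (q _) pE qE => {SM xM q M M'} L q pE qE eq1.
have D0 k l : \det (Xmx k n) ^+ l != 0 by rewrite expf_neq0 ?det_Xmx_neq0.
(* Stated over an arbitrary field because it serves over [K'] for the hypothesis and over [K] for
   the conclusion. *)
have sumE (E : fieldType) (u v : 'I_(size S) -> {mpoly E[n * n]}) k l :
    \sum_i ((u i)%:F / (\det (Xmx E n) ^+ k)%:F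
            * ((v i)%:F / (\det (Xmx E n) ^+ l)%:F))
    = (\sum_i u i * v i)%:F / (\det (Xmx E n) ^+ (k + l))%:F.
  rewrite rmorph_sum mulr_suml; apply: eq_bigr => i _.
  by rewrite mulf_tofrac exprD.
exists (fun i => (map_mpoly r (C i))%:F / (\det (Xmx K n) ^+ N)%:F).
  by move=> i; eexists; eexists.
under eq_bigr => i _ do rewrite pE.
rewrite sumE qE; apply: eqr_tofrac (D0 K _) (D0 K _) _.
(* With denominators cleared, everything except the [C i] is written as an image under [f], so that
   the [K[X]]-linear map [map_mpoly r] can be applied to both sides. *)
have {}eq1 : map_mpoly f q * map_mpoly f (\det (Xmx K n) ^+ (N + L))
    = (\sum_i C i * map_mpoly f (p i)) * map_mpoly f (\det (Xmx K n) ^+ L).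
  move: eq1; rewrite qE GLmapE.
  under eq_bigr => i _ do rewrite CE pE GLmapE.
  rewrite sumE => /frac_eq e; rewrite !rmorphXn /= !map_det_Xmx.
  exact: e (D0 K' _) (D0 K' _).
have /(congr1 (map_mpoly r)) := eq1.
rewrite !map_mpoly_retractionM // map_mpoly_retractionK // => ->; congr (_ * _).
rewrite raddf_sum; apply: eq_bigr => i _ /=.
by rewrite map_mpoly_retractionM.
Qed.

End Extension.

(** * Galois action, invariants and norms *)

Section GaloisDescent.
Variables (F : fieldType) (L : splittingFieldType F) (n : nat).
Hypothesis galL : galois 1%AS {:L}%AS.

Lemma GLmap_galM (s t : gal_of {:L}%AS) (x : FracX L n) :
  GLmap t (GLmap s x) = GLmap (s * t)%g x.
Proof. by apply: GLmap_comp => a; rewrite /= galM ?memvf. Qed.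

Lemma GLmap_galK (s : gal_of {:L}%AS) :
  cancel (@GLmap L L n s) (GLmap (s^-1)%g).
Proof.
by move=> x; rewrite GLmap_galM mulgV GLmap_id // => a; rewrite /= gal_id.
Qed.

Lemma GLmap_gal_in_alg (s : gal_of {:L}%AS) (x : FracX F n) :
  GLmap s (GLmap (in_alg L) x) = GLmap (in_alg L) x.
Proof. by apply: GLmap_comp => a; rewrite /= linearZ /= rmorph1. Qed.

(** The denominator is a power of the determinant and is fixed, so the numerator is fixed too. Its
    coefficients then lie in the fixed field, which is the base field. *)
Lemma GLring_gal_fixed (x : FracX L n) :
    GLring x -> (forall s : gal_of {:L}%AS, GLmap s x = x) ->
  exists2 y : FracX F n, GLring y & GLmap (in_alg L) y = x.
Proof.
move=> [p [k ->]] fixx.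
have fixp (s : gal_of {:L}%AS) : map_mpoly s p = p.
  have := fixx s; rewrite GLmapE => /frac_eq e.
  apply: (@mulIf _ (\det (Xmx L n) ^+ k)); last by apply: e; rewrite expf_neq0 ?det_Xmx_neq0.
  by rewrite expf_neq0 ?det_Xmx_neq0.
(* The retraction picks preimages of all the coefficients at once, so the numerator over [F] is
   simply [map_mpoly r p]. *)
have [r [rZ r1]] := field_ext_retraction (in_alg L).
exists ((map_mpoly r p)%:F / (\det (Xmx F n) ^+ k)%:F); first by eexists; eexists.
rewrite GLmapE; suff -> : map_mpoly (in_alg L) (map_mpoly r p) = p by [].
apply/mpolyP=> m; rewrite !mcoeff_map_mpoly.
have /vlineP[a ->] : p@_m \in 1%VS.
  rewrite -(galois_fixedField galL); apply/fixedFieldP; first exact: memvf.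
  by move=> s _; rewrite -mcoeff_map_mpoly fixp.
by rewrite -[a *: 1](mulr1 (in_alg L a)) rZ r1 mulr1 /= mulr1.
Qed.

Lemma gen_ideal_gal (s : gal_of {:L}%AS) (S : seq (FracX L n)) x :
  gen_ideal (@GLring L n) S x ->
  gen_ideal (@GLring L n) (map (GLmap s) S) (GLmap s x).
Proof. exact: gen_ideal_map. Qed.

Definition GLnorm (x : FracX L n) : FracX L n :=
  \prod_(s : gal_of {:L}%AS) GLmap s x.

Lemma GLnorm_fixed (x : FracX L n) (s : gal_of {:L}%AS) :
  GLmap s (GLnorm x) = GLnorm x.
Proof.
rewrite /GLnorm rmorph_prod [RHS](reindex_inj (mulIg s)).
by apply: eq_bigr => t _; exact: GLmap_galM.
Qed.

Lemma GLring_norm (x : FracX L n) : GLring x -> GLring (GLnorm x).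
Proof.
move=> xB; apply: big_ind; [exact: GLring1 | exact: GLringM |].
by move=> s _; apply: GLring_map.
Qed.

(** The factor of the norm at the identity is [x] itself. *)
Lemma GLnorm_ideal (I : FracX L n -> Prop) x :
  is_ideal (@GLring L n) I -> I x -> I (GLnorm x).
Proof.
move=> [IB _ _ IM] Ix; rewrite /GLnorm (bigD1 1%g) //= mulrC.
apply: IM; last by rewrite GLmap_id // => a; rewrite /= gal_id.
apply: big_ind => [||s _]; [exact: GLring1 | exact: GLringM |].
by apply/GLring_map/IB.
Qed.

(** Every conjugate of [x] is congruent to 1 modulo [I], hence so is their product. *)
Lemma GLnorm_sub1_ideal (I : FracX L n -> Prop) x :
    is_ideal (@GLring L n) I -> GLring x ->
    (forall s : gal_of {:L}%AS, I (GLmap s (x - 1))) -> I (GLnorm x - 1).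
Proof.
move=> [IB I0 ID IM] xB Ix.
suff [] : GLring (GLnorm x) /\ I (GLnorm x - 1) by [].
apply: (big_ind (fun y => GLring y /\ I (y - 1))).
- by rewrite subrr; split=> //; apply: GLring1.
- move=> y z [yB Iy] [zB Iz]; split; first exact: GLringM.
  have -> : y * z - 1 = y * (z - 1) + (y - 1) by ring.
  by apply: ID => //; apply: IM.
- move=> s _; split; first exact: GLring_map.
  by have := Ix s; rewrite rmorphB rmorph1.
Qed.

End GaloisDescent.

(** * The contraction of [Ibar] to [k[X, 1/det X]] and its maximality *)

Theorem mainTheorem5
  (C : closedFieldType) (charC0 : [pchar C] =i pred0)
  (* an algebraic closure of C(t), with an extension of d/dt *)
  (kbar : closedFieldType) (iota : {rmorphism ratfun C -> kbar})
  (iota_alg : forall z : kbar, algebraicOver iota z)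
  (dbar : kbar -> kbar) (dbar_der : is_derivation dbar)
  (dbar_ext : forall a : ratfun C, dbar (iota a) = iota (ddt a))
  (n : nat) (A : 'M[ratfun C]_n)
  (* a finite Galois extension of C(t) inside kbar *)
  (L : splittingFieldType (ratfun C)) (galL : galois 1%AS {:L}%AS)
  (j : {rmorphism L -> kbar}) (j_ext : forall a : ratfun C, j a%:A = iota a)
  (S : seq (FracX L n)) (S_sub : forall s, s \in S -> GLring s)
  (Ibar : FracX kbar n -> Prop)
  (Ibar_max : is_max_delta_ideal (@GLring kbar n)
                (GLder dbar (map_mx iota A)) Ibar)
  (Ibar_gen : forall f, Ibar f <-> gen_ideal (@GLring kbar n) (map (@GLmap L kbar n j) S) f)
  (* rho_1(S), ..., rho_d(S) is the orbit of S under Gal(L / C(t)) *)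
  (d : nat) (rho : 'I_d -> gal_of {:L}%AS)
  (rho_gal : forall i, rho i \in ('Gal({:L} / 1))%g)
  (rho_orbit : forall sigma : gal_of {:L}%AS, sigma \in ('Gal({:L} / 1))%g ->
     exists i, map (@GLmap L L n sigma) S =i map (@GLmap L L n (rho i)) S) :
  is_max_delta_ideal (@GLring (ratfun C) n) (GLder (@ddt C) A)
    (fun f : FracX (ratfun C) n =>
       GLring f /\
       forall i, gen_ideal (@GLring L n) (map (@GLmap L L n (rho i)) S)
                   (@GLmap (ratfun C) L n (in_alg L) f)).
Proof.
have ddt_der : is_derivation (@ddt C).
  by apply: frac_deriv_is_derivation; split=> p q; rewrite ?derivD ?derivM.
set Rk := @GLring (ratfun C) n; set RL := @GLring L n.
set Rb := @GLring kbar n; set m := (X in is_max_delta_ideal _ _ X).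
set D := GLder (@ddt C) A.
have subRL : is_subsemiring RL := GLring_subsemiring L n.
have subRb : is_subsemiring Rb := GLring_subsemiring kbar n.
pose phi := @GLmap (ratfun C) kbar n iota.
pose psi := @GLmap (ratfun C) L n (in_alg L).
have phiD x : phi (D x) = GLder dbar (map_mx iota A) (phi x).
  exact: GLmap_der.
have phiE x : GLmap j (psi x) = phi x by apply: GLmap_comp.
have [[Ibar_id IbarD] Ibar_proper Ibar_maximal] := Ibar_max.
have [IbarB Ibar0 IbarA IbarM] := Ibar_id.
(* [m] is the contraction of [Ibar]. The orbit of the identity provides at least one index [i], and
   the inverse of [rho i] carries membership back to the ideal of [S]. Conversely, membership
   descends from [kbar] to [L], and each [rho i] fixes the image of [f]. *)
have mE f : m f <-> Rk f /\ Ibar (phi f).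
  split=> [[fB fm]|[fB If]]; split=> //.
    have [i _] := rho_orbit 1%g (group1 _).
    apply/Ibar_gen; rewrite -phiE; apply: gen_ideal_map.
    have := gen_ideal_gal ((rho i)^-1)%g (fm i).
    by rewrite GLmap_gal_in_alg -map_comp (eq_map (GLmap_galK (rho i))) map_id.
  move=> i; rewrite -(GLmap_gal_in_alg (rho i)); apply: gen_ideal_gal.
  apply: (gen_ideal_descent (f := j)) => //; first exact: GLring_map.
  by apply/Ibar_gen; rewrite phiE.
have m_ideal : is_delta_ideal Rk D m.
  split; first split.
  - by move=> x [].
  - by apply/mE; split; [apply: GLring0 | rewrite /phi rmorph0].
  - move=> x y /mE[xB Ix] /mE[yB Iy]; apply/mE; split; first exact: GLringD.
    by rewrite /phi rmorphD; apply: IbarA.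
  - move=> b x bB /mE[xB Ix]; apply/mE; split; first exact: GLringM.
    by rewrite /phi rmorphM; apply: IbarM => //; apply: GLring_map.
  - move=> x /mE[xB Ix]; apply/mE; split; first exact: GLringder.
    by rewrite phiD; apply: IbarD.
split=> //.
  exists 1; first exact: GLring1.
  move=> /mE[_]; rewrite /phi rmorph1.
  exact: proper_ideal_not1 Ibar_id Ibar_proper.
move=> M [M_id MD] M_proper mM x Mx; have [MB M0 MA MM] := M_id.
have M1 := proper_ideal_not1 M_id M_proper.
pose Mbar := ext_ideal Rb phi M.
have phiB y : M y -> Rb (phi y) by move=> /MB yB; apply: GLring_map.
have Mbar_id : is_ideal Rb Mbar := ext_ideal_is_ideal subRb phiB.
have MbarD f : Mbar f -> Mbar (GLder dbar (map_mx iota A) f).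
  apply: (ext_ideal_der subRb phiB _ _ (fun y => esym (phiD y)) MD).
    exact: GLder_is_derivation.
  exact: GLringder.
(* [T] is a delta-ideal containing [Ibar], so by maximality of [Ibar] it is either contained in
   [Ibar] or contains 1. *)
pose T f := exists a b, [/\ Mbar a, Ibar b & f = a + b].
have T_id : is_ideal Rb T := is_idealD subRb Mbar_id Ibar_id.
have [_ Mbar0 _ _] := Mbar_id.
have TD f : T f -> T (GLder dbar (map_mx iota A) f).
  move=> [a [b [Ma Ib ->]]].
  have [-> _] := GLder_is_derivation (map_mx iota A) dbar_der.
  by exists (GLder dbar (map_mx iota A) a), (GLder dbar (map_mx iota A) b);
    split; [apply: MbarD | apply: IbarD | ].
have Mbar_phi : Mbar (phi x) := mem_ext_ideal subRb phi Mx.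
have [T1|T1] := EM (T 1); last first.
  apply/mE; split; first exact: MB.
  apply: (Ibar_maximal T).
  - exact: conj T_id TD.
  - by exists 1; [exact: GLring1 | exact: T1].
  - by move=> f If; exists 0, f; rewrite add0r; split; [exact: Mbar0 | exact: If | ].
  - by exists (phi x), 0; rewrite addr0; split; [exact: Mbar_phi | exact: Ibar0 | ].
(* When 1 lies in [T], it remains to derive [M 1]. Only the finitely many elements [s] of [M]
   occurring in [a] matter from here on. *)
case: M1; move: T1 => [a [b [[s sM as_] /Ibar_gen bS ab]]].
have psiB y : y \in map psi s -> RL y.
  by move=> /mapP[z /sM/MB zB ->]; apply: GLring_map.
have catB y : y \in map psi s ++ S -> RL y.
  by rewrite mem_cat => /orP[/psiB|/S_sub].
(* Joining the two lists of generators turns [1 = a + b] into a single membership, which descends to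
   [L] and is then split again. *)
have /(gen_ideal_cat subRL _ catB)[u [v [us vS uv]]] :
    gen_ideal RL (map psi s ++ S) 1.
  apply: (gen_ideal_descent (f := j) catB (GLring1 _ _)).
  have mapcatB y : y \in map phi s ++ map (@GLmap L kbar n j) S -> Rb y.
    rewrite mem_cat => /orP[/mapP[z /sM/phiB zB ->] //|/mapP[z /S_sub zB ->]].
    exact: GLring_map.
  rewrite rmorph1 map_cat -map_comp (eq_map phiE).
  by apply/(gen_ideal_cat subRb _ mapcatB); exists a, b.
have s_id : is_ideal RL (gen_ideal RL (map psi s)) := gen_ideal_is_ideal subRL psiB.
have S_id : is_ideal RL (gen_ideal RL S) := gen_ideal_is_ideal subRL S_sub.
have [SB _ _ _] := S_id; have vB := SB v vS.
have N1B y : is_ideal RL y -> forall z, y z -> y (- z).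
  move=> [_ _ _ yM] z yz; rewrite -mulN1r.
  by apply: yM => //; apply/GLringN/GLring1.
(* [g] is the norm of [v] seen over [k]. It lies in [m], because [v] is in the ideal of [S]. *)
have [g gB gv] := GLring_gal_fixed galL (GLring_norm vB) (GLnorm_fixed v).
have Mg : M g.
  apply/mM/mE; split; first exact: gB.
  rewrite -phiE [psi g]gv; apply/Ibar_gen/gen_ideal_map.
  exact: GLnorm_ideal.
(* The generators [psi s] come from [k], so their ideal is stable under the Galois group and
   contains every conjugate of [v - 1 = - u]. *)
have Nv : gen_ideal RL (map psi s) (GLnorm v - 1).
  apply: (GLnorm_sub1_ideal s_id vB) => sg.
  have -> : v - 1 = - u by rewrite uv opprD addrCA subrr addr0.
  have -> : map psi s = map (GLmap sg) (map psi s).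
    by rewrite -map_comp; apply: eq_map => y; rewrite /= GLmap_gal_in_alg.
  exact: gen_ideal_gal (N1B _ s_id _ us).
have gsM y : y \in g :: s -> M y by rewrite inE => /orP[/eqP ->|/sM].
apply: (gen_ideal_min M_id gsM).
(* Over [L], 1 is the norm of [v] minus an element of the ideal of [psi s]; descent to [k] puts 1 in
   the ideal of [g :: s], inside [M]. *)
apply: (gen_ideal_descent (f := in_alg L) _ (GLring1 _ _)).
  by move=> y /gsM/MB.
have gsB y : y \in map psi (g :: s) -> RL y.
  by move=> /mapP[z /gsM/MB zB ->]; apply: GLring_map.
have gs_id := gen_ideal_is_ideal subRL gsB; have [_ _ gsD _] := gs_id.
rewrite rmorph1 -[1](subKr (GLnorm v)); apply: gsD.
  by rewrite -gv; apply: (mem_gen_ideal subRL); apply: mem_head.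
apply: (N1B _ gs_id); move: Nv; apply: (sub_gen_ideal subRL gsB) => y ys.
by rewrite inE ys orbT.
Qed.
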